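(* Let $\mathsf{D}$ be a cartesian monoidal category, and let $(P,E,\delta)$ be an affine symmetric monoidal monad on $\mathsf{D}$ with lax monoidal structure maps $\nabla_{X,Y}\colon PX\times PY\to P(X\times Y)$. Then the canonical functor $\mathsf{D}\to\mathrm{Kl}(P)_{\det}$ is an isomorphism of categories if and only if for every object $X$ of $\mathsf{D}$ the commutative square $$\nabla_{X,X}\circ(\delta_X,\delta_X)=P(\mathrm{id}_X,\mathrm{id}_X)\circ\delta_X\colon X\to P(X\times X),$$ with legs $\delta_X\colon X\to PX$ and $(\delta_X,\delta_X)\colon X\to PX\times PX$, is a pullback of $P(\mathrm{id}_X,\mathrm{id}_X)\colon PX\to P(X\times X)$ and $\nabla_{X,X}\colon PX\times PX\to P(X\times X)$.
   Context: Coherence isomorphisms of monoidal categories are suppressed. A Markov category is a symmetric monoidal category whose unit $I$ is terminal, in which every object $X$ carries a distinguished morphism $\mathrm{copy}_X \colon X \to X\otimes X$ which together with the unique $\mathrm{del}_X\colon X\to I$ makes $X$ a commutative comonoid, and such that $\mathrm{copy}_{X\otimes Y} = (\mathrm{id}_X\otimes \mathrm{swap}_{X,Y}\otimes \mathrm{id}_Y)\circ(\mathrm{copy}_X\otimes \mathrm{copy}_Y)$. A morphism $f\colon X\to Y$ in a Markov category $\mathsf{C}$ is deterministic if $\mathrm{copy}_Y\circ f=(f\otimes f)\circ \mathrm{copy}_X$; deterministic morphisms form a subcategory $\mathsf{C}_{\det}$ with the same objects. A symmetric monoidal monad on a cartesian monoidal category $\mathsf{D}$ is a monad $(P,E,\delta)$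 (multiplication $E$, unit $\delta$) where $P$ is a symmetric lax monoidal functor, with structure maps $\nabla$, and $E,\delta$ are monoidal natural transformations; it is affine if $P(I)\cong I$ for the terminal object $I$. The Kleisli category $\mathrm{Kl}(P)$ is then a Markov category: the monoidal product on objects is the product of $\mathsf{D}$, the monoidal product of Kleisli morphisms represented by $f\colon A\to PX$ and $g\colon B\to PY$ is represented by $\nabla_{X,Y}\circ(f\times g)$, and $\mathrm{copy}_X$ is represented by $\delta_{X\times X}\circ(\mathrm{id}_X,\mathrm{id}_X)\colon X\to P(X\times X)$. The canonical functor $\mathsf{D}\to\mathrm{Kl}(P)$ is the identity on objects and sends $f\colon X\to Y$ to the Kleisli morphism represented by $\delta_Y\circ f\colon X\to PY$; it takes values in $\mathrm{Kl}(P)_{\det}$. *)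

(* Defs.v *)
From Stdlib Require Import ssreflect ProofIrrelevance.

Set Implicit Arguments.
Unset Strict Implicit.
Unset Printing Implicit Defensive.

Declare Scope cat_scope.
Delimit Scope cat_scope with cat.
Local Open Scope cat_scope.

Reserved Notation "g ∘ f" (at level 40, left associativity).
Reserved Notation "X ⊗ Y" (at level 39, left associativity).
Reserved Notation "f ⊠ g" (at level 39, left associativity).

Record Category := {
  Ob :> Type;
  Hom : Ob -> Ob -> Type;
  idm : forall X, Hom X X;
  comp : forall X Y Z, Hom Y Z -> Hom X Y -> Hom X Z;
  comp_idl : forall X Y (f : Hom X Y), comp (idm Y) f = f;
  comp_idr : forall X Y (f : Hom X Y), comp f (idm X) = f;
  comp_assoc : forall W X Y Z (f : Hom W X) (g : Hom X Y) (h : Hom Y Z),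
    comp h (comp g f) = comp (comp h g) f
}.
Arguments Hom {c} X Y.
Arguments idm {c} X.
Arguments comp {c X Y Z} g f.
Arguments comp_idl {c X Y} f.
Arguments comp_idr {c X Y} f.
Arguments comp_assoc {c W X Y Z} f g h.
Notation "g ∘ f" := (comp g f) : cat_scope.

Definition isomorphic (C : Category) (X Y : C) : Prop :=
  exists (f : Hom X Y) (g : Hom Y X), g ∘ f = idm X /\ f ∘ g = idm Y.

(* [p1 : P -> X] and [p2 : P -> Y] form a pullback of [f : X -> Z] and
   [g : Y -> Z]. *)
Definition is_pullback (C : Category) (P X Y Z : C)
    (f : Hom X Z) (g : Hom Y Z) (p1 : Hom P X) (p2 : Hom P Y) : Prop :=
  f ∘ p1 = g ∘ p2 /\
  forall (A : C) (a : Hom A X) (b : Hom A Y), f ∘ a = g ∘ b ->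
    exists! u : Hom A P, p1 ∘ u = a /\ p2 ∘ u = b.

Record Functor (C D : Category) := {
  fob :> C -> D;
  fmap : forall X Y, Hom X Y -> Hom (fob X) (fob Y);
  fmap_id : forall X, fmap (idm X) = idm (fob X);
  fmap_comp : forall X Y Z (f : Hom X Y) (g : Hom Y Z),
    fmap (g ∘ f) = fmap g ∘ fmap f
}.
Arguments fmap {C D} F {X Y} f : rename.
Arguments fmap_id {C D} F X : rename.
Arguments fmap_comp {C D} F {X Y Z} f g : rename.

Definition functor_id (C : Category) : Functor C C :=
  {| fob := fun X => X;
     fmap := fun X Y f => f;
     fmap_id := fun X => eq_refl;
     fmap_comp := fun X Y Z f g => eq_refl |}.

Lemma functor_comp_id_ax (C D E : Category) (G : Functor D E) (F : Functor C D)
  (X : C) : fmap G (fmap F (idm X)) = idm (G (F X)).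
Proof. by rewrite !fmap_id. Qed.

Lemma functor_comp_comp_ax (C D E : Category) (G : Functor D E)
  (F : Functor C D) (X Y Z : C) (f : Hom X Y) (g : Hom Y Z) :
  fmap G (fmap F (g ∘ f)) = fmap G (fmap F g) ∘ fmap G (fmap F f).
Proof. by rewrite !fmap_comp. Qed.

Definition functor_comp (C D E : Category) (G : Functor D E)
    (F : Functor C D) : Functor C E :=
  {| fob := fun X => G (F X);
     fmap := fun X Y f => fmap G (fmap F f);
     fmap_id := functor_comp_id_ax G F;
     fmap_comp := functor_comp_comp_ax G F |}.

(* Equality of functors is strict (on objects as well as on morphisms). *)
Definition is_isomorphism_of_categories (C D : Category) (F : Functor C D)
    : Prop :=
  exists G : Functor D C,
    functor_comp G F = functor_id C /\ functor_comp F G = functor_id D.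

Record NatTrans (C D : Category) (F G : Functor C D) := {
  nt :> forall X, Hom (F X) (G X);
  nt_natural : forall X Y (f : Hom X Y), nt Y ∘ fmap F f = fmap G f ∘ nt X
}.

Record Monad (C : Category) := {
  mfun :> Functor C C;
  munit : NatTrans (functor_id C) mfun;
  mmult : NatTrans (functor_comp mfun mfun) mfun;
  mmult_unitl : forall X, mmult X ∘ munit (mfun X) = idm (mfun X);
  mmult_unitr : forall X, mmult X ∘ fmap mfun (munit X) = idm (mfun X);
  mmult_assoc : forall X, mmult X ∘ mmult (mfun X) = mmult X ∘ fmap mfun (mmult X)
}.

Record SymMonCat := {
  smc_cat :> Category;
  unit_ob : smc_cat;
  tens : smc_cat -> smc_cat -> smc_cat;
  tensm : forall X Y X' Y' : smc_cat,
    Hom X X' -> Hom Y Y' -> Hom (tens X Y) (tens X' Y');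
  tens_id : forall X Y, tensm (idm X) (idm Y) = idm (tens X Y);
  tens_comp : forall X Y Z X' Y' Z' (f : Hom X Y) (g : Hom Y Z)
      (f' : Hom X' Y') (g' : Hom Y' Z'),
    tensm (g ∘ f) (g' ∘ f') = tensm g g' ∘ tensm f f';
  assoc : forall X Y Z, Hom (tens (tens X Y) Z) (tens X (tens Y Z));
  assoc_inv : forall X Y Z, Hom (tens X (tens Y Z)) (tens (tens X Y) Z);
  assocK : forall X Y Z, assoc_inv X Y Z ∘ assoc X Y Z = idm _;
  assoc_invK : forall X Y Z, assoc X Y Z ∘ assoc_inv X Y Z = idm _;
  assoc_natural : forall X Y Z X' Y' Z'
      (f : Hom X X') (g : Hom Y Y') (h : Hom Z Z'),
    assoc X' Y' Z' ∘ tensm (tensm f g) h = tensm f (tensm g h) ∘ assoc X Y Z;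
  lunit : forall X, Hom (tens unit_ob X) X;
  lunit_inv : forall X, Hom X (tens unit_ob X);
  lunitK : forall X, lunit_inv X ∘ lunit X = idm _;
  lunit_invK : forall X, lunit X ∘ lunit_inv X = idm _;
  lunit_natural : forall X Y (f : Hom X Y),
    lunit Y ∘ tensm (idm unit_ob) f = f ∘ lunit X;
  runit : forall X, Hom (tens X unit_ob) X;
  runit_inv : forall X, Hom X (tens X unit_ob);
  runitK : forall X, runit_inv X ∘ runit X = idm _;
  runit_invK : forall X, runit X ∘ runit_inv X = idm _;
  runit_natural : forall X Y (f : Hom X Y),
    runit Y ∘ tensm f (idm unit_ob) = f ∘ runit X;
  swap : forall X Y, Hom (tens X Y) (tens Y X);
  swapK : forall X Y, swap Y X ∘ swap X Y = idm _;
  swap_natural : forall X Y X' Y' (f : Hom X X') (g : Hom Y Y'),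
    swap X' Y' ∘ tensm f g = tensm g f ∘ swap X Y;
  pentagon : forall W X Y Z,
    assoc W X (tens Y Z) ∘ assoc (tens W X) Y Z
    = tensm (idm W) (assoc X Y Z)
      ∘ (assoc W (tens X Y) Z ∘ tensm (assoc W X Y) (idm Z));
  triangle : forall X Y,
    tensm (idm X) (lunit Y) ∘ assoc X unit_ob Y = tensm (runit X) (idm Y);
  hexagon : forall X Y Z,
    assoc Y Z X ∘ (swap X (tens Y Z) ∘ assoc X Y Z)
    = tensm (idm Y) (swap X Z) ∘ (assoc Y X Z ∘ tensm (swap X Y) (idm Z))
}.
Arguments unit_ob {s}.
Arguments tens {s} X Y.
Arguments tensm {s X Y X' Y'} f g.
Arguments assoc {s} X Y Z.
Arguments assoc_inv {s} X Y Z.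
Arguments lunit {s} X.
Arguments lunit_inv {s} X.
Arguments runit {s} X.
Arguments runit_inv {s} X.
Arguments swap {s} X Y.
Notation "X ⊗ Y" := (tens X Y) : cat_scope.
Notation "f ⊠ g" := (tensm f g) : cat_scope.

(* The morphism written id ⊗ swap ⊗ id when associators are suppressed. *)
Definition mid_swap (C : SymMonCat) (W X Y Z : C) :
    Hom ((W ⊗ X) ⊗ (Y ⊗ Z)) ((W ⊗ Y) ⊗ (X ⊗ Z)) :=
  assoc_inv W Y (X ⊗ Z)
  ∘ ((idm W ⊠ (assoc Y X Z ∘ ((swap X Y ⊠ idm Z) ∘ assoc_inv X Y Z)))
  ∘ assoc W X (Y ⊗ Z)).

Record LaxSymMonoidal (C D : SymMonCat) (F : Functor C D) := {
  lax_unit : Hom unit_ob (F unit_ob);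
  lax_tens : forall X Y : C, Hom (F X ⊗ F Y) (F (X ⊗ Y));
  lax_natural : forall X Y X' Y' (f : Hom X X') (g : Hom Y Y'),
    lax_tens X' Y' ∘ (fmap F f ⊠ fmap F g) = fmap F (f ⊠ g) ∘ lax_tens X Y;
  lax_assoc : forall X Y Z,
    fmap F (assoc X Y Z) ∘ (lax_tens (X ⊗ Y) Z ∘ (lax_tens X Y ⊠ idm (F Z)))
    = lax_tens X (Y ⊗ Z) ∘ ((idm (F X) ⊠ lax_tens Y Z) ∘ assoc (F X) (F Y) (F Z));
  lax_lunit : forall X,
    fmap F (lunit X) ∘ (lax_tens unit_ob X ∘ (lax_unit ⊠ idm (F X)))
    = lunit (F X);
  lax_runit : forall X,
    fmap F (runit X) ∘ (lax_tens X unit_ob ∘ (idm (F X) ⊠ lax_unit))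
    = runit (F X);
  lax_swap : forall X Y,
    fmap F (swap X Y) ∘ lax_tens X Y = lax_tens Y X ∘ swap (F X) (F Y)
}.

Lemma comp_eq2 (C : Category) (W X Y Y' Z : C) (a : Hom Y Z) (b : Hom X Y)
  (c : Hom Y' Z) (d : Hom X Y') (h : Hom W X) :
  a ∘ b = c ∘ d -> a ∘ (b ∘ h) = c ∘ (d ∘ h).
Proof. by move=> e; rewrite !comp_assoc e. Qed.

Lemma comp_eq1 (C : Category) (W X Y Z : C) (a : Hom Y Z) (b : Hom X Y)
  (c : Hom X Z) (h : Hom W X) :
  a ∘ b = c -> a ∘ (b ∘ h) = c ∘ h.
Proof. by move=> e; rewrite !comp_assoc e. Qed.

Section LaxIdComp.

Variables (C D E : SymMonCat).

Definition lax_id : LaxSymMonoidal (functor_id C).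
Proof.
refine {| lax_unit := (idm unit_ob : @Hom C unit_ob (functor_id C unit_ob));
          lax_tens := fun X Y =>
            (idm (X ⊗ Y) : @Hom C (functor_id C X ⊗ functor_id C Y)
                                  (functor_id C (X ⊗ Y))) |} => /= *;
  by rewrite ?tens_id ?comp_idl ?comp_idr ?tens_id ?comp_idl ?comp_idr.
Defined.

Variables (G : Functor D E) (F : Functor C D).
Variables (lG : LaxSymMonoidal G) (lF : LaxSymMonoidal F).

Let u : Hom unit_ob (functor_comp G F unit_ob) :=
  fmap G (lax_unit lF) ∘ lax_unit lG.
Let t (X Y : C) : Hom (functor_comp G F X ⊗ functor_comp G F Y)
                      (functor_comp G F (X ⊗ Y)) :=
  fmap G (lax_tens lF X Y) ∘ lax_tens lG (F X) (F Y).

Lemma tens_compl (S : SymMonCat) (X Y Z W : S) (f : Hom X Y) (g : Hom Y Z) :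
  (g ∘ f) ⊠ idm W = (g ⊠ idm W) ∘ (f ⊠ idm W).
Proof. by rewrite -tens_comp comp_idl. Qed.

Lemma tens_compr (S : SymMonCat) (X Y Z W : S) (f : Hom X Y) (g : Hom Y Z) :
  idm W ⊠ (g ∘ f) = (idm W ⊠ g) ∘ (idm W ⊠ f).
Proof. by rewrite -tens_comp comp_idl. Qed.

Lemma lax_natl (X X' : D) (Y : D) (f : Hom X X') :
  lax_tens lG X' Y ∘ (fmap G f ⊠ idm (G Y)) = fmap G (f ⊠ idm Y) ∘ lax_tens lG X Y.
Proof. by rewrite -lax_natural fmap_id. Qed.

Lemma lax_natr (X X' : D) (Y : D) (f : Hom X X') :
  lax_tens lG Y X' ∘ (idm (G Y) ⊠ fmap G f) = fmap G (idm Y ⊠ f) ∘ lax_tens lG Y X.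
Proof. by rewrite -lax_natural fmap_id. Qed.

Lemma lax_comp_natural (X Y X' Y' : C) (f : Hom X X') (g : Hom Y Y') :
  t X' Y' ∘ (fmap (functor_comp G F) f ⊠ fmap (functor_comp G F) g)
  = fmap (functor_comp G F) (f ⊠ g) ∘ t X Y.
Proof.
rewrite /t /= -comp_assoc lax_natural.
by apply: comp_eq2; rewrite -!fmap_comp lax_natural.
Qed.

Lemma lax_comp_assoc (X Y Z : C) :
  fmap (functor_comp G F) (assoc X Y Z)
    ∘ (t (X ⊗ Y) Z ∘ (t X Y ⊠ idm (functor_comp G F Z)))
  = t X (Y ⊗ Z) ∘ ((idm (functor_comp G F X) ⊠ t Y Z) ∘ assoc _ _ _).
Proof.
rewrite /t /= tens_compl tens_compr -!comp_assoc.
rewrite (comp_eq2 _ (lax_natl _ _)) (comp_eq2 _ (lax_natr _ _)) -lax_assoc.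
rewrite [LHS]comp_assoc [LHS]comp_assoc [RHS]comp_assoc [RHS]comp_assoc.
by rewrite -!fmap_comp -!comp_assoc lax_assoc.
Qed.

Lemma lax_comp_lunit (X : C) :
  fmap (functor_comp G F) (lunit X)
    ∘ (t unit_ob X ∘ (u ⊠ idm (functor_comp G F X)))
  = lunit (functor_comp G F X).
Proof.
rewrite /t /u /= tens_compl -!comp_assoc (comp_eq2 _ (lax_natl _ _)).
rewrite [LHS]comp_assoc [LHS]comp_assoc -!fmap_comp -!comp_assoc.
by rewrite lax_lunit lax_lunit.
Qed.

Lemma lax_comp_runit (X : C) :
  fmap (functor_comp G F) (runit X)
    ∘ (t X unit_ob ∘ (idm (functor_comp G F X) ⊠ u))
  = runit (functor_comp G F X).
Proof.
rewrite /t /u /= tens_compr -!comp_assoc (comp_eq2 _ (lax_natr _ _)).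
rewrite [LHS]comp_assoc [LHS]comp_assoc -!fmap_comp -!comp_assoc.
by rewrite lax_runit lax_runit.
Qed.

Lemma lax_comp_swap (X Y : C) :
  fmap (functor_comp G F) (swap X Y) ∘ t X Y
  = t Y X ∘ swap (functor_comp G F X) (functor_comp G F Y).
Proof.
by rewrite /t /= -comp_assoc -lax_swap; apply: comp_eq2; rewrite -!fmap_comp lax_swap.
Qed.

Definition lax_comp : LaxSymMonoidal (functor_comp G F) :=
  {| lax_unit := u;
     lax_tens := t;
     lax_natural := lax_comp_natural;
     lax_assoc := lax_comp_assoc;
     lax_lunit := lax_comp_lunit;
     lax_runit := lax_comp_runit;
     lax_swap := lax_comp_swap |}.

End LaxIdComp.
Arguments lax_id C : clear implicits.

Definition is_monoidal_nat_trans (C D : SymMonCat) (F G : Functor C D)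
    (lF : LaxSymMonoidal F) (lG : LaxSymMonoidal G) (a : NatTrans F G) : Prop :=
  a unit_ob ∘ lax_unit lF = lax_unit lG /\
  forall X Y, a (X ⊗ Y) ∘ lax_tens lF X Y = lax_tens lG X Y ∘ (a X ⊠ a Y).

Record SymMonoidalMonad (C : SymMonCat) := {
  smm_monad :> Monad C;
  smm_lax : LaxSymMonoidal smm_monad;
  smm_unit_monoidal :
    is_monoidal_nat_trans (lax_id C) smm_lax (munit smm_monad);
  smm_mult_monoidal :
    is_monoidal_nat_trans (lax_comp smm_lax smm_lax) smm_lax (mmult smm_monad)
}.
Arguments smm_lax {C} T : rename.

Definition affine (C : SymMonCat) (T : SymMonoidalMonad C) : Prop :=
  isomorphic (T unit_ob) (unit_ob : C).

Record MarkovCategory := {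
  mk_smc :> SymMonCat;
  del : forall X : mk_smc, Hom X unit_ob;
  del_unique : forall (X : mk_smc) (f : Hom X unit_ob), f = del X;
  copy : forall X : mk_smc, Hom X (X ⊗ X);
  copy_assoc : forall X,
    assoc X X X ∘ ((copy X ⊠ idm X) ∘ copy X) = (idm X ⊠ copy X) ∘ copy X;
  copy_counitl : forall X, lunit X ∘ ((del X ⊠ idm X) ∘ copy X) = idm X;
  copy_counitr : forall X, runit X ∘ ((idm X ⊠ del X) ∘ copy X) = idm X;
  copy_comm : forall X, swap X X ∘ copy X = copy X;
  copy_tens : forall X Y,
    copy (X ⊗ Y) = mid_swap X X Y Y ∘ (copy X ⊠ copy Y)
}.
Arguments del {m} X.
Arguments copy {m} X.

Definition deterministic (C : MarkovCategory) (X Y : C) (f : Hom X Y) : Prop :=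
  copy Y ∘ f = (f ⊠ f) ∘ copy X.

Section DetCategory.

Variable C : MarkovCategory.

Lemma deterministic_id (X : C) : deterministic (idm X).
Proof. by rewrite /deterministic tens_id comp_idl comp_idr. Qed.

Lemma deterministic_comp (X Y Z : C) (f : Hom X Y) (g : Hom Y Z) :
  deterministic f -> deterministic g -> deterministic (g ∘ f).
Proof.
rewrite /deterministic => hf hg.
by rewrite tens_comp comp_assoc hg -!comp_assoc hf.
Qed.

Definition det_hom (X Y : C) : Type := {f : Hom X Y | deterministic f}.

Definition det_id (X : C) : det_hom X X := exist _ (idm X) (deterministic_id X).

Definition det_comp (X Y Z : C) (g : det_hom Y Z) (f : det_hom X Y) :
    det_hom X Z :=
  exist _ (proj1_sig g ∘ proj1_sig f)
    (deterministic_comp (proj2_sig f) (proj2_sig g)).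

Lemma det_hom_eq (X Y : C) (f g : det_hom X Y) :
  proj1_sig f = proj1_sig g -> f = g.
Proof. by case: f g => [f hf] [g hg] /= e; apply: subset_eq_compat. Qed.

Lemma det_comp_idl (X Y : C) (f : det_hom X Y) : det_comp (det_id Y) f = f.
Proof. by apply: det_hom_eq; rewrite /= comp_idl. Qed.

Lemma det_comp_idr (X Y : C) (f : det_hom X Y) : det_comp f (det_id X) = f.
Proof. by apply: det_hom_eq; rewrite /= comp_idr. Qed.

Lemma det_comp_assoc (W X Y Z : C) (f : det_hom W X) (g : det_hom X Y)
  (h : det_hom Y Z) : det_comp h (det_comp g f) = det_comp (det_comp h g) f.
Proof. by apply: det_hom_eq; rewrite /= comp_assoc. Qed.

Definition det_category : Category :=
  {| Ob := C;
     Hom := det_hom;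
     idm := det_id;
     comp := det_comp;
     comp_idl := det_comp_idl;
     comp_idr := det_comp_idr;
     comp_assoc := det_comp_assoc |}.

(* A functor all of whose values are deterministic, seen as a functor to the
   subcategory of deterministic morphisms. *)
Variables (B : Category) (F : Functor B C).
Hypothesis Fdet : forall X Y (f : Hom X Y), deterministic (fmap F f).

Let cf (X Y : B) (f : Hom X Y) : @Hom det_category (F X) (F Y) :=
  exist _ (fmap F f) (Fdet f).

Lemma det_corestrict_id (X : B) : cf (idm X) = idm _.
Proof. by apply: det_hom_eq; rewrite /= fmap_id. Qed.

Lemma det_corestrict_comp (X Y Z : B) (f : Hom X Y) (g : Hom Y Z) :
  cf (g ∘ f) = cf g ∘ cf f.
Proof. by apply: det_hom_eq; rewrite /= fmap_comp. Qed.

Definition det_corestrict : Functor B det_category :=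
  {| fob := fun X => F X : det_category;
     fmap := cf;
     fmap_id := det_corestrict_id;
     fmap_comp := det_corestrict_comp |}.

End DetCategory.

Record CartesianCategory := {
  cart_cat :> Category;
  one : cart_cat;
  bang : forall X, Hom X one;
  bang_unique : forall X (f : Hom X one), f = bang X;
  bprod : cart_cat -> cart_cat -> cart_cat;
  pr1 : forall X Y, Hom (bprod X Y) X;
  pr2 : forall X Y, Hom (bprod X Y) Y;
  pairing : forall X Y Z, Hom Z X -> Hom Z Y -> Hom Z (bprod X Y);
  pair_pr1 : forall X Y Z (f : Hom Z X) (g : Hom Z Y), pr1 X Y ∘ pairing f g = f;
  pair_pr2 : forall X Y Z (f : Hom Z X) (g : Hom Z Y), pr2 X Y ∘ pairing f g = g;
  pair_unique : forall X Y Z (h : Hom Z (bprod X Y)),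
    h = pairing (pr1 X Y ∘ h) (pr2 X Y ∘ h)
}.
Arguments one {c}.
Arguments bang {c} X.
Arguments bprod {c} X Y.
Arguments pr1 {c} X Y.
Arguments pr2 {c} X Y.
Arguments pairing {c X Y Z} f g.

Section CartesianMonoidal.

Variable D : CartesianCategory.

Definition prodm (X Y X' Y' : D) (f : Hom X X') (g : Hom Y Y') :
    Hom (bprod X Y) (bprod X' Y') :=
  pairing (f ∘ pr1 X Y) (g ∘ pr2 X Y).

Definition prod_assoc (X Y Z : D) :
    Hom (bprod (bprod X Y) Z) (bprod X (bprod Y Z)) :=
  pairing (pr1 X Y ∘ pr1 _ Z) (pairing (pr2 X Y ∘ pr1 _ Z) (pr2 _ Z)).

Definition prod_assoc_inv (X Y Z : D) :
    Hom (bprod X (bprod Y Z)) (bprod (bprod X Y) Z) :=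
  pairing (pairing (pr1 X _) (pr1 Y Z ∘ pr2 X _)) (pr2 Y Z ∘ pr2 X _).

Definition prod_swap (X Y : D) : Hom (bprod X Y) (bprod Y X) :=
  pairing (pr2 X Y) (pr1 X Y).

Lemma pair_ext (X Y Z : D) (h k : Hom Z (bprod X Y)) :
  pr1 X Y ∘ h = pr1 X Y ∘ k -> pr2 X Y ∘ h = pr2 X Y ∘ k -> h = k.
Proof. by move=> h1 h2; rewrite (pair_unique h) (pair_unique k) h1 h2. Qed.

Lemma pair_pr1a (X Y Z W : D) (f : Hom Z X) (g : Hom Z Y) (h : Hom W Z) :
  pr1 X Y ∘ (pairing f g ∘ h) = f ∘ h.
Proof. by rewrite comp_assoc pair_pr1. Qed.

Lemma pair_pr2a (X Y Z W : D) (f : Hom Z X) (g : Hom Z Y) (h : Hom W Z) :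
  pr2 X Y ∘ (pairing f g ∘ h) = g ∘ h.
Proof. by rewrite comp_assoc pair_pr2. Qed.

Definition cart_simpl :=
  (pair_pr1, pair_pr2, pair_pr1a, pair_pr2a).

Ltac cart :=
  intros; rewrite /prodm /prod_assoc /prod_assoc_inv /prod_swap;
  repeat first
    [ match goal with
      |- ?f = ?g => constr_eq f g; reflexivity
      end
    | exact: eq_trans (bang_unique _) (eq_sym (bang_unique _))
    | progress rewrite -?comp_assoc ?cart_simpl ?comp_idl ?comp_idr
    | apply: pair_ext ].

Lemma prodm_id (X Y : D) : prodm (idm X) (idm Y) = idm (bprod X Y).
Proof. cart. Qed.

Lemma prodm_comp (X Y Z X' Y' Z' : D) (f : Hom X Y) (g : Hom Y Z)
  (f' : Hom X' Y') (g' : Hom Y' Z') :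
  prodm (g ∘ f) (g' ∘ f') = prodm g g' ∘ prodm f f'.
Proof. cart. Qed.

Lemma prod_assocK (X Y Z : D) : prod_assoc_inv X Y Z ∘ prod_assoc X Y Z = idm _.
Proof. cart. Qed.

Lemma prod_assoc_invK (X Y Z : D) :
  prod_assoc X Y Z ∘ prod_assoc_inv X Y Z = idm _.
Proof. cart. Qed.

Lemma prod_assoc_natural (X Y Z X' Y' Z' : D)
  (f : Hom X X') (g : Hom Y Y') (h : Hom Z Z') :
  prod_assoc X' Y' Z' ∘ prodm (prodm f g) h
  = prodm f (prodm g h) ∘ prod_assoc X Y Z.
Proof. cart. Qed.

Lemma prod_lunitK (X : D) : pairing (bang X) (idm X) ∘ pr2 one X = idm _.
Proof. cart. Qed.

Lemma prod_lunit_natural (X Y : D) (f : Hom X Y) :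
  pr2 one Y ∘ prodm (idm one) f = f ∘ pr2 one X.
Proof. cart. Qed.

Lemma prod_runitK (X : D) : pairing (idm X) (bang X) ∘ pr1 X one = idm _.
Proof. cart. Qed.

Lemma prod_runit_natural (X Y : D) (f : Hom X Y) :
  pr1 Y one ∘ prodm f (idm one) = f ∘ pr1 X one.
Proof. cart. Qed.

Lemma prod_swapK (X Y : D) : prod_swap Y X ∘ prod_swap X Y = idm _.
Proof. cart. Qed.

Lemma prod_swap_natural (X Y X' Y' : D) (f : Hom X X') (g : Hom Y Y') :
  prod_swap X' Y' ∘ prodm f g = prodm g f ∘ prod_swap X Y.
Proof. cart. Qed.

Lemma prod_pentagon (W X Y Z : D) :
  prod_assoc W X (bprod Y Z) ∘ prod_assoc (bprod W X) Y Z
  = prodm (idm W) (prod_assoc X Y Z)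
    ∘ (prod_assoc W (bprod X Y) Z ∘ prodm (prod_assoc W X Y) (idm Z)).
Proof. cart. Qed.

Lemma prod_triangle (X Y : D) :
  prodm (idm X) (pr2 one Y) ∘ prod_assoc X one Y = prodm (pr1 X one) (idm Y).
Proof. cart. Qed.

Lemma prod_hexagon (X Y Z : D) :
  prod_assoc Y Z X ∘ (prod_swap X (bprod Y Z) ∘ prod_assoc X Y Z)
  = prodm (idm Y) (prod_swap X Z)
    ∘ (prod_assoc Y X Z ∘ prodm (prod_swap X Y) (idm Z)).
Proof. cart. Qed.

Canonical cartesian_smc : SymMonCat :=
  {| smc_cat := D;
     unit_ob := one;
     tens := @bprod D;
     tensm := prodm;
     tens_id := prodm_id;
     tens_comp := prodm_comp;
     assoc := prod_assoc;
     assoc_inv := prod_assoc_inv;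
     assocK := prod_assocK;
     assoc_invK := prod_assoc_invK;
     assoc_natural := prod_assoc_natural;
     lunit := fun X => pr2 one X;
     lunit_inv := fun X => pairing (bang X) (idm X);
     lunitK := prod_lunitK;
     lunit_invK := fun X => pair_pr2 (bang X) (idm X);
     lunit_natural := prod_lunit_natural;
     runit := fun X => pr1 X one;
     runit_inv := fun X => pairing (idm X) (bang X);
     runitK := prod_runitK;
     runit_invK := fun X => pair_pr1 (idm X) (bang X);
     runit_natural := prod_runit_natural;
     swap := prod_swap;
     swapK := prod_swapK;
     swap_natural := prod_swap_natural;
     pentagon := prod_pentagon;
     triangle := prod_triangle;
     hexagon := prod_hexagon |}.

Definition diag (X : D) : Hom X (bprod X X) := pairing (idm X) (idm X).

Lemma diag_natural (X Y : D) (f : Hom X Y) : diag Y ∘ f = prodm f f ∘ diag X.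
Proof. rewrite /diag; cart. Qed.

Lemma diag_assoc (X : D) :
  prod_assoc X X X ∘ (prodm (diag X) (idm X) ∘ diag X)
  = prodm (idm X) (diag X) ∘ diag X.
Proof. rewrite /diag; cart. Qed.

Lemma diag_counitl (X : D) :
  pr2 one X ∘ (prodm (bang X) (idm X) ∘ diag X) = idm X.
Proof. rewrite /diag; cart. Qed.

Lemma diag_counitr (X : D) :
  pr1 X one ∘ (prodm (idm X) (bang X) ∘ diag X) = idm X.
Proof. rewrite /diag; cart. Qed.

Lemma diag_comm (X : D) : prod_swap X X ∘ diag X = diag X.
Proof. rewrite /diag; cart. Qed.

Lemma diag_tens (X Y : D) :
  diag (bprod X Y)
  = @mid_swap cartesian_smc X X Y Y ∘ prodm (diag X) (diag Y).
Proof. rewrite /mid_swap /= /diag; cart. Qed.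

End CartesianMonoidal.
Arguments diag {D} X.

Section Kleisli.

Variables (C : SymMonCat) (T : SymMonoidalMonad C).

Notation η := (munit T).
Notation μ := (mmult T).
Notation "∇" := (lax_tens (smm_lax T)).

Definition kl_comp (X Y Z : C) (g : Hom Y (T Z)) (f : Hom X (T Y)) :
    Hom X (T Z) :=
  μ Z ∘ (fmap T g ∘ f).

Definition kl_pure (X Y : C) (f : Hom X Y) : Hom X (T Y) := η Y ∘ f.

Definition kl_tensm (X Y X' Y' : C) (f : Hom X (T X')) (g : Hom Y (T Y')) :
    Hom (X ⊗ Y) (T (X' ⊗ Y')) :=
  ∇ X' Y' ∘ (f ⊠ g).

Lemma kl_comp_purel (X Y Z : C) (g : Hom Y Z) (f : Hom X (T Y)) :
  kl_comp (kl_pure g) f = fmap T g ∘ f.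
Proof.
rewrite /kl_comp /kl_pure fmap_comp -comp_assoc.
by rewrite (comp_eq1 _ (mmult_unitr _ _)) comp_idl.
Qed.

Lemma kl_comp_purer (X Y Z : C) (g : Hom Y (T Z)) (f : Hom X Y) :
  kl_comp g (kl_pure f) = g ∘ f.
Proof.
rewrite /kl_comp /kl_pure -(comp_eq2 _ (nt_natural η g)) /=.
by rewrite (comp_eq1 _ (mmult_unitl _ _)) comp_idl.
Qed.

Lemma kl_comp_pure (X Y Z : C) (g : Hom Y Z) (f : Hom X Y) :
  kl_comp (kl_pure g) (kl_pure f) = kl_pure (g ∘ f).
Proof. by rewrite kl_comp_purer /kl_pure comp_assoc. Qed.

Lemma kl_comp_idl (X Y : C) (f : Hom X (T Y)) : kl_comp (η Y) f = f.
Proof. by rewrite /kl_comp (comp_eq1 _ (mmult_unitr _ _)) comp_idl. Qed.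

Lemma kl_comp_idr (X Y : C) (f : Hom X (T Y)) : kl_comp f (η X) = f.
Proof.
rewrite /kl_comp -(nt_natural η f) /=.
by rewrite (comp_eq1 _ (mmult_unitl _ _)) comp_idl.
Qed.

Lemma kl_comp_assoc (W X Y Z : C) (f : Hom W (T X)) (g : Hom X (T Y))
  (h : Hom Y (T Z)) : kl_comp h (kl_comp g f) = kl_comp (kl_comp h g) f.
Proof.
rewrite /kl_comp !fmap_comp -!comp_assoc -(comp_eq2 _ (mmult_assoc _ _)).
by rewrite -(comp_eq2 _ (nt_natural μ h)).
Qed.

Definition kleisli : Category :=
  {| Ob := C;
     Hom := fun X Y => Hom X (T Y);
     idm := fun X => η X;
     comp := kl_comp;
     comp_idl := kl_comp_idl;
     comp_idr := kl_comp_idr;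
     comp_assoc := kl_comp_assoc |}.

Lemma kl_pure_id (X : C) : kl_pure (idm X) = η X.
Proof. exact: comp_idr. Qed.

Definition kleisli_functor : Functor C kleisli :=
  {| fob := fun X : C => X : kleisli;
     fmap := kl_pure;
     fmap_id := kl_pure_id;
     fmap_comp := fun X Y Z f g => eq_sym (kl_comp_pure g f) |}.

Lemma unit_tens (X Y : C) : ∇ X Y ∘ (η X ⊠ η Y) = η (X ⊗ Y).
Proof. by case: (smm_unit_monoidal T) => _ <-; rewrite /= comp_idr. Qed.

Lemma unit_unit : lax_unit (smm_lax T) = η unit_ob.
Proof. by case: (smm_unit_monoidal T) => <- _; rewrite /= comp_idr. Qed.

Lemma mult_tens (X Y : C) :
  ∇ X Y ∘ (μ X ⊠ μ Y) = μ (X ⊗ Y) ∘ (fmap T (∇ X Y) ∘ ∇ (T X) (T Y)).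
Proof. by case: (smm_mult_monoidal T) => _ <-. Qed.

Lemma kl_tensm_pure (X Y X' Y' : C) (f : Hom X X') (g : Hom Y Y') :
  kl_tensm (kl_pure f) (kl_pure g) = kl_pure (f ⊠ g).
Proof. by rewrite /kl_tensm /kl_pure tens_comp comp_assoc unit_tens. Qed.

Lemma kl_tensm_pureid (X Y X' : C) (f : Hom X X') :
  kl_tensm (kl_pure f) (η Y) = kl_pure (f ⊠ idm Y).
Proof. by rewrite -kl_pure_id kl_tensm_pure. Qed.

Lemma kl_tensm_idpure (X Y X' : C) (f : Hom X X') :
  kl_tensm (η Y) (kl_pure f) = kl_pure (idm Y ⊠ f).
Proof. by rewrite -kl_pure_id kl_tensm_pure. Qed.

Definition kl_pureE :=
  (kl_comp_pure, kl_tensm_pure, kl_tensm_pureid, kl_tensm_idpure).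

Lemma kl_tens_comp (X Y Z X' Y' Z' : C) (f : Hom X (T Y)) (g : Hom Y (T Z))
  (f' : Hom X' (T Y')) (g' : Hom Y' (T Z')) :
  kl_tensm (kl_comp g f) (kl_comp g' f')
  = kl_comp (kl_tensm g g') (kl_tensm f f').
Proof.
rewrite /kl_tensm /kl_comp !tens_comp !fmap_comp -!comp_assoc.
rewrite (comp_eq1 _ (mult_tens _ _)) -!comp_assoc.
by rewrite /= (comp_eq2 _ (lax_natural _ _ _)).
Qed.

Lemma kl_assoc_natural (X Y Z X' Y' Z' : C) (f : Hom X (T X'))
  (g : Hom Y (T Y')) (h : Hom Z (T Z')) :
  kl_comp (kl_pure (assoc X' Y' Z')) (kl_tensm (kl_tensm f g) h)
  = kl_comp (kl_tensm f (kl_tensm g h)) (kl_pure (assoc X Y Z)).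
Proof.
rewrite kl_comp_purel kl_comp_purer /kl_tensm.
rewrite -{1}(comp_idl h) -{2}(comp_idl f) !tens_comp -!comp_assoc.
rewrite -assoc_natural.
have e := lax_assoc (smm_lax T) X' Y' Z'.
rewrite !comp_assoc in e *.
by rewrite e.
Qed.

Lemma kl_lunit_natural (X Y : C) (f : Hom X (T Y)) :
  kl_comp (kl_pure (lunit Y)) (kl_tensm (η unit_ob) f)
  = kl_comp f (kl_pure (lunit X)).
Proof.
rewrite kl_comp_purel kl_comp_purer /kl_tensm -unit_unit -lunit_natural.
rewrite -(lax_lunit (smm_lax T)) -!comp_assoc.
by rewrite -tens_comp comp_idl comp_idr.
Qed.

Lemma kl_runit_natural (X Y : C) (f : Hom X (T Y)) :
  kl_comp (kl_pure (runit Y)) (kl_tensm f (η unit_ob))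
  = kl_comp f (kl_pure (runit X)).
Proof.
rewrite kl_comp_purel kl_comp_purer /kl_tensm -unit_unit -runit_natural.
rewrite -(lax_runit (smm_lax T)) -!comp_assoc.
by rewrite -tens_comp comp_idl comp_idr.
Qed.

Lemma kl_swap_natural (X Y X' Y' : C) (f : Hom X (T X')) (g : Hom Y (T Y')) :
  kl_comp (kl_pure (swap X' Y')) (kl_tensm f g)
  = kl_comp (kl_tensm g f) (kl_pure (swap X Y)).
Proof.
rewrite kl_comp_purel kl_comp_purer /kl_tensm.
by rewrite (comp_eq2 _ (lax_swap _ _ _)) swap_natural comp_assoc.
Qed.

Ltac pure_law e := intros; rewrite /= !kl_pureE e ?kl_pure_id //.

Definition kleisli_smc : SymMonCat.
Proof.
refine {| smc_cat := kleisli;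
          unit_ob := unit_ob : C;
          tens := fun X Y : C => X ⊗ Y;
          tensm := kl_tensm;
          tens_id := unit_tens;
          tens_comp := kl_tens_comp;
          assoc := fun X Y Z => kl_pure (assoc X Y Z);
          assoc_inv := fun X Y Z => kl_pure (assoc_inv X Y Z);
          assoc_natural := kl_assoc_natural;
          lunit := fun X => kl_pure (lunit X);
          lunit_inv := fun X => kl_pure (lunit_inv X);
          lunit_natural := kl_lunit_natural;
          runit := fun X => kl_pure (runit X);
          runit_inv := fun X => kl_pure (runit_inv X);
          runit_natural := kl_runit_natural;
          swap := fun X Y => kl_pure (swap X Y);
          swap_natural := kl_swap_natural |}.
- abstract (pure_law (@assocK C)).
- abstract (pure_law (@assoc_invK C)).
- abstract (pure_law (@lunitK C)).
- abstract (pure_law (@lunit_invK C)).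
- abstract (pure_law (@runitK C)).
- abstract (pure_law (@runit_invK C)).
- abstract (pure_law (@swapK C)).
- abstract (pure_law (@pentagon C)).
- abstract (pure_law (@triangle C)).
- abstract (pure_law (@hexagon C)).
Defined.

End Kleisli.

Section KleisliMarkov.

Variables (D : CartesianCategory) (T : SymMonoidalMonad (cartesian_smc D)).
Hypothesis Taff : affine T.

Lemma affine_unique (X : D) (f g : Hom X (T one)) : f = g.
Proof.
case: Taff => i [j [ji _]].
rewrite -(comp_idl f) -(comp_idl g) -ji -!comp_assoc; congr comp.
exact: eq_trans (bang_unique _) (eq_sym (bang_unique _)).
Qed.

Lemma kl_copy_assoc (X : D) :
  kl_comp (kl_pure T (prod_assoc X X X))
    (kl_comp (kl_tensm (kl_pure T (diag X)) (munit T X)) (kl_pure T (diag X)))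
  = kl_comp (kl_tensm (munit T X) (kl_pure T (diag X))) (kl_pure T (diag X)).
Proof. by rewrite !kl_pureE; apply: f_equal; apply: diag_assoc. Qed.

Lemma kl_copy_counitl (X : D) :
  kl_comp (kl_pure T (pr2 one X))
    (kl_comp (kl_tensm (kl_pure T (bang X)) (munit T X)) (kl_pure T (diag X)))
  = munit T X.
Proof.
by rewrite !kl_pureE -[RHS]kl_pure_id; apply: f_equal; apply: diag_counitl.
Qed.

Lemma kl_copy_counitr (X : D) :
  kl_comp (kl_pure T (pr1 X one))
    (kl_comp (kl_tensm (munit T X) (kl_pure T (bang X))) (kl_pure T (diag X)))
  = munit T X.
Proof.
by rewrite !kl_pureE -[RHS]kl_pure_id; apply: f_equal; apply: diag_counitr.
Qed.

Lemma kl_copy_comm (X : D) :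
  kl_comp (kl_pure T (prod_swap X X)) (kl_pure T (diag X)) = kl_pure T (diag X).
Proof. by rewrite kl_pureE; apply: f_equal; apply: diag_comm. Qed.

Lemma kl_copy_tens (X Y : kleisli_smc T) :
  kl_pure T (@diag D (bprod X Y))
  = mid_swap X X Y Y ∘ kl_tensm (kl_pure T (@diag D X)) (kl_pure T (@diag D Y)).
Proof.
by rewrite /mid_swap /= !kl_pureE; apply: f_equal; apply: diag_tens.
Qed.

Definition kleisli_markov : MarkovCategory :=
  {| mk_smc := kleisli_smc T;
     del := fun X : D => kl_pure T (bang X);
     del_unique := fun X f => affine_unique f (kl_pure T (bang X));
     copy := fun X : D => kl_pure T (diag X);
     copy_assoc := kl_copy_assoc;
     copy_counitl := kl_copy_counitl;
     copy_counitr := kl_copy_counitr;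
     copy_comm := kl_copy_comm;
     copy_tens := kl_copy_tens |}.

Lemma kleisli_functor_det (X Y : D) (f : Hom X Y) :
  @deterministic kleisli_markov X Y (fmap (kleisli_functor T) f).
Proof.
by rewrite /deterministic /= !kl_pureE; refine (f_equal (@kl_pure (cartesian_smc D) T _ _) _); apply: diag_natural.
Qed.

Definition canonical_functor : Functor D (det_category kleisli_markov) :=
  det_corestrict (C := kleisli_markov) (F := kleisli_functor T)
    kleisli_functor_det.

End KleisliMarkov.

(* Main.v *)
From Stdlib Require Import ssreflect FunctionalExtensionality ClassicalEpsilon
  ProofIrrelevance.
Require Import Defs.

Set Implicit Arguments.
Unset Strict Implicit.
Unset Printing Implicit Defensive.

Local Open Scope cat_scope.

(** The canonical functor is the identity on objects, so it is an isomorphism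
    exactly when every deterministic [f : A -> PX] factors uniquely through
    [δ_X].  Determinism of [f] reads [P(id,id) ∘ f = ∇ ∘ (f,f)], i.e. [f] and
    [(f,f)] form a cone over the cospan of the square.  Conversely every cone
    [(a, b)] has this form: by affinity the marginals of [∇] are the two
    projections, so postcomposing with [P(pr1)] and [P(pr2)] gives
    [b = (a, a)]. *)

Definition full (C D : Category) (F : Functor C D) : Prop :=
  forall (X Y : C) (f : Hom (F X) (F Y)), exists u : Hom X Y, fmap F u = f.

Definition faithful (C D : Category) (F : Functor C D) : Prop :=
  forall (X Y : C) (u v : Hom X Y), fmap F u = fmap F v -> u = v.

Lemma faithful_of_comp (C D E : Category) (G : Functor D E) (F : Functor C D) :
  faithful (functor_comp G F) -> faithful F.
Proof. by move=> GF X Y u v e; apply: GF; rewrite /= e. Qed.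

Lemma isomorphism_faithful (C D : Category) (F : Functor C D) :
  is_isomorphism_of_categories F -> faithful F.
Proof. by case=> G [GF _]; apply: (@faithful_of_comp _ _ _ G); rewrite GF. Qed.

(** Strict equality with the identity makes [functor_comp G F] full and [G] faithful. A preimage of
    [fmap G f] under the composite is then a preimage of [f] under [F], with no transport along
    equalities of objects. *)
Lemma isomorphism_full (C D : Category) (F : Functor C D) :
  is_isomorphism_of_categories F -> full F.
Proof.
case=> G [GF FG] X Y f.
have GF_full : full (functor_comp G F).
  by rewrite GF => A B g; exists g.
have G_faithful : faithful G.
  by apply: (@faithful_of_comp _ _ _ F); rewrite FG.
have [u e] := GF_full X Y (fmap G f).
by exists u; apply: G_faithful.
Qed.

(** Sharing the object map [o] gives both morphism maps the same type, so they can be compared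
    pointwise; the functor laws then agree by proof irrelevance. *)
Lemma functor_eq (C D : Category) (o : C -> D)
  (m m' : forall X Y, Hom X Y -> Hom (o X) (o Y)) i i' c c' :
  (forall X Y (f : Hom X Y), m X Y f = m' X Y f) ->
  {| fob := o; fmap := m; fmap_id := i; fmap_comp := c |}
  = {| fob := o; fmap := m'; fmap_id := i'; fmap_comp := c' |}.
Proof.
move=> e; have em : m = m'.
  by do 3 (apply: functional_extensionality_dep => ?); apply: e.
by subst m'; f_equal; apply: proof_irrelevance.
Qed.

Section Canonical.

Variables (D : CartesianCategory) (T : SymMonoidalMonad (cartesian_smc D)).
Hypothesis Taff : affine T.

Notation η := (munit T).
Notation "∇" := (lax_tens (smm_lax T)).

(** Copying is a pure Kleisli morphism, so both Kleisli composites collapse to composites in [D]; on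
    the right, [f ⊠ f] after the diagonal is [pairing f f]. *)
Lemma kl_deterministicE (A X : D) (f : Hom A (T X)) :
  @deterministic (kleisli_markov Taff) A X f <->
  fmap T (diag X) ∘ f = ∇ X X ∘ pairing f f.
Proof.
rewrite /deterministic /=.
rewrite kl_comp_purel kl_comp_purer /kl_tensm -comp_assoc.
suff -> : @tensm (cartesian_smc D) _ _ _ _ f f ∘ diag A = pairing f f by [].
by apply: pair_ext; rewrite /= /prodm /diag !cart_simpl -?comp_assoc ?cart_simpl
  ?comp_idr.
Qed.

(** The projection deletes [Y] and then applies the right unitor, so naturality of [∇] reduces the
    claim to the lax right unit law. *)
Lemma marginal1 (X Y : D) : fmap T (pr1 X Y) ∘ ∇ X Y = pr1 (T X) (T Y).
Proof.
have -> : pr1 X Y = pr1 X one ∘ prodm (idm X) (bang Y).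
  by rewrite /prodm cart_simpl comp_idl.
rewrite fmap_comp -comp_assoc -(lax_natural (smm_lax T)) fmap_id.
(* Affinity enters here: all maps into [T one] agree, so [fmap T (bang Y)] may be replaced by a map
   through [lax_unit]. *)
rewrite (affine_unique Taff (fmap T (bang Y)) (lax_unit (smm_lax T) ∘ bang _)).
have -> : idm (T X) ⊠ (lax_unit (smm_lax T) ∘ bang (T Y))
    = (idm (T X) ⊠ lax_unit (smm_lax T)) ∘ (idm (T X) ⊠ bang (T Y)).
  exact: tens_compr.
have /= e := lax_runit (smm_lax T) X.
rewrite !comp_assoc -(comp_assoc _ (∇ X one)) e.
by rewrite /= /prodm cart_simpl comp_idl.
Qed.

Lemma marginal2 (X Y : D) : fmap T (pr2 X Y) ∘ ∇ X Y = pr2 (T X) (T Y).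
Proof.
have -> : pr2 X Y = pr2 one Y ∘ prodm (bang X) (idm Y).
  by rewrite /prodm cart_simpl comp_idl.
rewrite fmap_comp -comp_assoc -(lax_natural (smm_lax T)) fmap_id.
rewrite (affine_unique Taff (fmap T (bang X)) (lax_unit (smm_lax T) ∘ bang _)).
have -> : (lax_unit (smm_lax T) ∘ bang (T X)) ⊠ idm (T Y)
    = (lax_unit (smm_lax T) ⊠ idm (T Y)) ∘ (bang (T X) ⊠ idm (T Y)).
  exact: tens_compl.
have /= e := lax_lunit (smm_lax T) Y.
rewrite !comp_assoc -(comp_assoc _ (∇ one Y)) e.
by rewrite /= /prodm cart_simpl comp_idl.
Qed.

(** The diagonal is a section of both projections, so taking the two marginals of the cone equation
    recovers each component of [b] as [a]. *)
Lemma cone_diagonal (A X : D) (a : Hom A (T X)) (b : Hom A (bprod (T X) (T X))) :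
  fmap T (diag X) ∘ a = ∇ X X ∘ b -> b = pairing a a.
Proof.
move=> e; apply: pair_ext; rewrite cart_simpl.
- rewrite -marginal1 -comp_assoc -e comp_assoc -fmap_comp /diag cart_simpl.
  by rewrite fmap_id comp_idl.
- rewrite -marginal2 -comp_assoc -e comp_assoc -fmap_comp /diag cart_simpl.
  by rewrite fmap_id comp_idl.
Qed.

(** Existence of mediating maps corresponds to fullness, and their uniqueness to faithfulness. *)
Lemma pullback_iff_fully_faithful :
  (forall X : D,
    is_pullback (C := D) (fmap T (diag X)) (∇ X X) (η X) (pairing (η X) (η X)))
  <-> full (canonical_functor Taff) /\ faithful (canonical_functor Taff).
Proof.
have detP (A X : D) (u : Hom A X) :
    fmap T (diag X) ∘ (η X ∘ u) = ∇ X X ∘ pairing (η X ∘ u) (η X ∘ u).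
  by apply/kl_deterministicE; apply: kleisli_functor_det.
have pairE (A X : D) (u : Hom A X) :
    pairing (η X) (η X) ∘ u = pairing (η X ∘ u) (η X ∘ u).
  by apply: pair_ext; rewrite !cart_simpl.
split=> [pb|[F_full F_faithful] X].
  split=> [A X [f fdet]|A X u v e].
    have /kl_deterministicE e := fdet.
    have [u [[uf _] _]] := proj2 (pb X) A f (pairing f f) e.
    by exists u; apply: det_hom_eq.
  have {}e : η X ∘ u = η X ∘ v := f_equal (@proj1_sig _ _) e.
  (* Both [u] and [v] mediate the cone with first leg [η X ∘ u], hence both equal [w]. *)
  have [w [_ w_unique]] := proj2 (pb X) A _ _ (detP A X u).
  rewrite -(w_unique u) ?pairE //.
  by apply: w_unique; rewrite pairE e.
split; first by have := detP X X (idm X); rewrite comp_idr.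
move=> A a b e.
(* Once the cone is diagonal, its equation says exactly that [a] is deterministic, so fullness
   applies. *)
have eb := cone_diagonal e; subst b.
have adet : @deterministic (kleisli_markov Taff) A X a.
  exact/kl_deterministicE.
have [u eu] := F_full A X (exist _ a adet).
have {}eu : η X ∘ u = a := f_equal (@proj1_sig _ _) eu.
exists u; split; first by rewrite pairE eu.
move=> v [ev _]; apply: F_faithful; apply: det_hom_eq.
by rewrite /= /kl_pure eu ev.
Qed.

Lemma canonical_isomorphism :
  full (canonical_functor Taff) -> faithful (canonical_functor Taff) ->
  is_isomorphism_of_categories (canonical_functor Taff).
Proof.
set F := canonical_functor Taff => F_full F_faithful.
(* Fullness only asserts that preimages exist, so the inverse on morphisms is obtained by choice;
   faithfulness makes it functorial. *)
pose g (X Y : D) (f : Hom (F X) (F Y)) : Hom X Y :=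
  proj1_sig (constructive_indefinite_description _ (F_full X Y f)).
have gK (X Y : D) (f : Hom (F X) (F Y)) : fmap F (g X Y f) = f.
  exact: (proj2_sig (constructive_indefinite_description _ (F_full X Y f))).
have g_id (X : D) : g X X (idm (F X)) = idm X.
  by apply: F_faithful; rewrite gK fmap_id.
have g_comp (X Y Z : D) (f : Hom (F X) (F Y)) (h : Hom (F Y) (F Z)) :
    g X Z (h ∘ f) = g Y Z h ∘ g X Y f.
  by apply: F_faithful; rewrite fmap_comp !gK.
exists (@Build_Functor (det_category (kleisli_markov Taff)) D
  (fun X => X) g g_id g_comp).
(* [F] and its inverse both fix objects definitionally, so only the morphism maps remain to be
   compared. *)
split; apply: functor_eq => X Y f; last exact: gK.
by apply: F_faithful; apply: gK.
Qed.

End Canonical.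

Theorem proposition3p4 (D : CartesianCategory)
    (T : SymMonoidalMonad (cartesian_smc D)) (Taff : affine T) :
  is_isomorphism_of_categories (canonical_functor Taff) <->
  forall X : D,
    is_pullback (C := D)
      (fmap T (pairing (idm X) (idm X)))
      (lax_tens (smm_lax T) X X)
      (munit T X)
      (pairing (munit T X) (munit T X)).
Proof.
split=> [iso|/(pullback_iff_fully_faithful Taff) [F_full F_faithful]].
  apply/(pullback_iff_fully_faithful Taff).
  by split; [apply: isomorphism_full|apply: isomorphism_faithful].
exact: canonical_isomorphism.
Qed.
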